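(* Let $(\mathbb{T},\tau)$ be a real torus, let $M$ be the character lattice of $\mathbb{T}$, and let $\tilde\tau$ be the involution of $M$ induced by $\tau$. Let $\omega$ be a full dimensional cone in $M_{\mathbb{Q}}$ with $\tilde\tau(\omega)=\omega$. Let $(Y,\sigma_Y)$ be a normal semi-projective $\mathbb{R}$-variety and let $\mathcal{D}$ be a proper $\omega^{\vee}$-polyhedral divisor on $Y$. If there exists a monoid morphism $h:\omega\cap M\to\mathbb{C}(Y)^*$ such that for all $m\in\omega\cap M$ $$\sigma_Y^*(\mathcal{D}(m))=\mathcal{D}(\tilde\tau(m))+\mathrm{div}_Y(h(\tilde\tau(m)))\quad\text{and}\quad h(m)\,\sigma_Y^{\sharp}(h(\tilde\tau(m)))=1,$$ then there exists an $\mathbb{R}$-structure $\sigma_{X[Y,\mathcal{D}]}$ on the normal affine variety $X[Y,\mathcal{D}]$ such that the real torus $(\mathbb{T},\tau)$ acts on the $\mathbb{R}$-variety $(X[Y,\mathcal{D}],\sigma_{X[Y,\mathcal{D}]})$ (the underlying $\mathbb{T}$-action on $X[Y,\mathcal{D}]$ being the one given by the $M$-grading).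
   Context: A $\mathbb{C}$-variety is a separated integral scheme of finite type over $\mathbb{C}$. An $\mathbb{R}$-structure on a $\mathbb{C}$-variety $X$ is an involution $\sigma$ of the $\mathbb{R}$-scheme $X$ lying over the automorphism of $\mathrm{Spec}(\mathbb{C})$ induced by complex conjugation. Quasi-projective $\mathbb{R}$-varieties are identified with pairs $(X,\sigma)$ of a quasi-projective $\mathbb{C}$-variety with an $\mathbb{R}$-structure; an adjective such as normal or semi-projective applied to $(X,\sigma)$ refers to $X$. An $\mathbb{R}$-morphism $(X,\sigma)\to(X',\sigma')$ is a morphism of $\mathbb{C}$-varieties $f$ with $\sigma'\circ f=f\circ\sigma$. An $\mathbb{R}$-group structure on a complex algebraic group is an $\mathbb{R}$-structure for which multiplication, inverse and unit are $\mathbb{R}$-morphisms. A real torus $(\mathbb{T},\tau)$ is a complex torus $\mathbb{T}\cong\mathbb{G}_{m,\mathbb{C}}^n$ with an $\mathbb{R}$-group structure $\tau$. Let $M=\mathrm{Hom}_{gr}(\mathbb{T},\mathbb{G}_{m,\mathbb{C}})$ be its character lattice, $N$ the dual lattice, $M_{\mathbb{Q}}=M\otimes\mathbb{Q}$, $N_{\mathbb{Q}}=N\otimes\mathbb{Q}$; $\tau$ induces a lattice involution $\tilde\tau$ of $M$ by $\tau^{\sharp}(\chi^m)=\chi^{\tilde\tau(m)}$, extended linearly to $M_{\mathbb{Q}}$. $(\mathbb{T},\tau)$ acts on $(X,\sigma)$ if $\mathbb{T}$ acts on $X$ through $\mu:\mathbb{T}\times X\to X$ with $\sigma\circ\mu=\mu\circ(\tau\times\sigma)$.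 All torus actions are assumed effective. A cone is a convex polyhedral cone (finitely generated, over $\mathbb{Q}_{\ge0}$). It is pointed (strongly convex) if it contains no line. The dual of $\omega_N\subset N_{\mathbb{Q}}$ is $\omega_N^\vee=\{u\in M_{\mathbb{Q}}\mid \langle u,v\rangle\ge0\ \forall v\in\omega_N\}$, and similarly for cones in $M_{\mathbb{Q}}$; $\mathrm{Relint}$ is the relative interior. For a pointed cone $\omega_N\subset N_{\mathbb{Q}}$, an $\omega_N$-polyhedron is a convex polyhedron $\Delta=\Pi+\omega_N$ in $N_{\mathbb{Q}}$ with $\Pi$ a polytope (tail cone $\omega_N$). A $\mathbb{C}$-variety $Y$ is semi-projective if $\mathrm{H}^0(Y,\mathcal{O})$ is a finitely generated $\mathbb{C}$-algebra and $Y$ is projective over $\mathrm{Spec}(\mathrm{H}^0(Y,\mathcal{O}))$. For $Y$ normal, an $\omega_N$-polyhedral divisor on $Y$ is a formal sum $\mathcal{D}=\sum_Z\Delta_Z\otimes Z$ over prime divisors $Z\subset Y$, with $\Delta_Z$ an $\omega_N$-polyhedron, equal to $\omega_N$ for all but finitely many $Z$. For $m\in\omega_N^\vee$ put $\mathcal{D}(m)=\sum_Z\min_{v\in\Delta_Z}\langle m,v\rangle\, Z$, a Weil $\mathbb{Q}$-divisor. For a Weil $\mathbb{Q}$-divisor $D$, $\mathrm{H}^0(Y,\mathcal{O}_Y(D))=\{f\in\mathbb{C}(Y)^*\mid \mathrm{div}(f)+D\ge0\}\cup\{0\}$. A Cartier $\mathbb{Q}$-divisor $D$ is semi-ample if for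 some $n\ge1$ the open sets $Y_f=Y\setminus\mathrm{Supp}(\mathrm{div}(f)+nD)$, $f\in\mathrm{H}^0(Y,\mathcal{O}_Y(nD))$, cover $Y$; it is big if for some $n\ge1$ some such $Y_f$ is affine. $\mathcal{D}$ is proper (an $\omega_N$-pp-divisor) if $\mathcal{D}(m)$ is a semi-ample Cartier $\mathbb{Q}$-divisor for all $m\in\omega_N^\vee\cap M$ and is big for all $m\in\mathrm{Relint}(\omega_N^\vee)\cap M$. For $\mathcal{D}$ a pp-divisor on a normal semi-projective $Y$, set $A[Y,\mathcal{D}]=\bigoplus_{m\in\omega_N^\vee\cap M}\mathrm{H}^0(Y,\mathcal{O}_Y(\mathcal{D}(m)))\,\mathfrak{X}_m\subset\mathbb{C}(Y)[M]$ ($\mathfrak{X}_m$ an indeterminate of weight $m$, $\mathfrak{X}_m\mathfrak{X}_{m'}=\mathfrak{X}_{m+m'}$) and $X[Y,\mathcal{D}]=\mathrm{Spec}(A[Y,\mathcal{D}])$; by Altmann–Hausen it is a normal affine variety with effective $\mathbb{T}$-action defined by the $M$-grading. For an $\mathbb{R}$-structure $\sigma_Y$ on $Y$, $\sigma_Y^*$ is pullback of ($\mathbb{Q}$-)divisors and $\sigma_Y^{\sharp}:\mathbb{C}(Y)\to\mathbb{C}(Y)$ is the induced (antilinear) field automorphism. Here $\omega=\omega_N^\vee$ with $\omega_N=\omega^\vee$. *)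

(* Defs.v *)
(* An integral scheme is given by its points, its topology and its local rings
   inside the function field K: the structure sheaf of an integral scheme is the
   subsheaf U |-> \bigcap_(x in U) O_x of the constant sheaf K on nonempty open
   sets.  Equalities of morphisms between affine schemes are equalities of
   comorphisms between coordinate rings. *)

From HB Require Import structures.
From mathcomp Require Import all_boot all_order all_algebra fraction finmap.
From mathcomp Require Import boolp classical_sets functions cardinality reals.
From mathcomp Require Import topology complex.
From mathcomp Require Import monalg.
Set Implicit Arguments.
Unset Strict Implicit.
Unset Printing Implicit Defensive.
Import Order.TTheory GRing.Theory Num.Theory.
Local Open Scope fset_scope.
Local Open Scope classical_set_scope.
Local Open Scope ring_scope.

Section ClassicalUnits.
Context (B : comNzRingType).

Definition cunit : pred B := fun x => `[< exists y, y * x = 1 >].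
Definition cinv (x : B) : B := xget x [set y | y * x = 1].

Lemma cinvV : {in cunit, left_inverse 1 cinv *%R}.
Proof.
move=> x /asboolP[y yx]; rewrite /cinv.
by case: xgetP => [z _ //|/(_ y)]; case.
Qed.

Lemma cunitP (x y : B) : y * x = 1 -> cunit x.
Proof. by move=> yx; apply/asboolP; exists y. Qed.

Lemma cinv_out : {in [predC cunit], cinv =1 id}.
Proof.
move=> x /negP xN; rewrite /cinv.
case: xgetP => // y _ /= yx; case: xN; exact: (cunitP yx).
Qed.

End ClassicalUnits.

(* [monalg] only makes [{malg B[G]}] a ring when no two non-trivial elements of
   G multiply to the unit, which excludes groups. *)
Definition galg (B : nzRingType) (G : zmodType) := {malg B[G]}.

Section GroupAlgebra.
Context (B : comNzRingType) (G : zmodType).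
Implicit Types (f g : galg B G) (k : G) (c : B).

HB.instance Definition _ := GRing.Zmodule.on (galg B G).

Definition gone : galg B G := << 1 *g 0 >>.
Definition gmul f g : galg B G :=
  \sum_(k <- msupp f) \sum_(l <- msupp g) << f@_k * g@_l *g k + l >>.

Lemma gmulw (d1 d2 : {fset G}) f g :
  (msupp f `<=` d1)%fset -> (msupp g `<=` d2)%fset ->
  gmul f g = \sum_(k <- d1) \sum_(l <- d2) << f@_k * g@_l *g k + l >>.
Proof.
move=> le1 le2; rewrite /gmul (big_fset_incl _ le1) /=.
  apply/eq_bigr=> k _; apply/big_fset_incl => // l _ /mcoeff_outdom ->.
  by rewrite mulr0 monalgU0.
move=> k _ /mcoeff_outdom fk.
by rewrite big1 => // l _; rewrite fk mul0r monalgU0.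
Qed.

Lemma gmulUU c d k l : gmul << c *g k >> << d *g l >> = << c * d *g k + l >>.
Proof. by rewrite (gmulw msuppU_le msuppU_le) !big_seq_fset1 !mcoeffUU. Qed.

Lemma gmulC : commutative gmul.
Proof.
move=> f g; rewrite /gmul exchange_big; apply: eq_bigr => l _.
by apply: eq_bigr => k _; rewrite mulrC addrC.
Qed.

Lemma gmulDl : left_distributive gmul +%R.
Proof.
move=> f g h.
rewrite [in RHS](gmulw (fsubsetUl _ (msupp g)) (fsubset_refl (msupp h))).
rewrite [in RHS](gmulw (fsubsetUr (msupp f) _) (fsubset_refl (msupp h))).
rewrite (gmulw (msuppD_le _ _) (fsubset_refl (msupp h))).
rewrite -big_split /=; apply/eq_bigr=> k _.
rewrite -big_split /=; apply/eq_bigr=> l _.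
by rewrite mcoeffD mulrDl monalgUD.
Qed.

Lemma gmulDr : right_distributive gmul +%R.
Proof. by move=> f g h; rewrite !(gmulC f) gmulDl. Qed.

Lemma gmul0g : left_zero 0 gmul.
Proof. by move=> g; rewrite /gmul msupp0 big_seq_fset0. Qed.

Lemma gmulg0 : right_zero 0 gmul.
Proof. by move=> g; rewrite gmulC gmul0g. Qed.

Lemma gmul1g : left_id gone gmul.
Proof.
move=> g; rewrite (gmulw msuppU_le (fsubset_refl _)) big_seq_fset1.
rewrite [RHS]monalgE; apply/eq_bigr => k _.
by rewrite mcoeffUU mul1r add0r.
Qed.

Lemma gmul_suml (I : Type) (r : seq I) (F : I -> galg B G) g :
  gmul (\sum_(i <- r) F i) g = \sum_(i <- r) gmul (F i) g.
Proof. exact: (big_morph (gmul^~ g) (fun _ _ => gmulDl _ _ _) (gmul0g _)). Qed.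

Lemma gmul_sumr (I : Type) (r : seq I) (F : I -> galg B G) g :
  gmul g (\sum_(i <- r) F i) = \sum_(i <- r) gmul g (F i).
Proof. exact: (big_morph (gmul g) (gmulDr g) (gmulg0 g)). Qed.

Lemma gmulA : associative gmul.
Proof.
move=> f g h; rewrite [f]monalgE [g]monalgE [h]monalgE.
rewrite [LHS]gmul_suml [X in _ = gmul X _]gmul_suml [RHS]gmul_suml.
apply: eq_bigr => i _; rewrite [X in gmul _ X = _]gmul_suml.
rewrite [LHS]gmul_sumr [X in _ = gmul X _]gmul_sumr [RHS]gmul_suml.
apply: eq_bigr => j _; rewrite [X in gmul _ X = _]gmul_sumr [LHS]gmul_sumr.
rewrite [RHS]gmul_sumr; apply: eq_bigr => k _.
by rewrite !gmulUU mulrA addrA.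
Qed.

Lemma gone_neq0 : gone != 0.
Proof. by rewrite monalgU_eq0 oner_eq0. Qed.

HB.instance Definition _ := GRing.Zmodule_isComNzRing.Build (galg B G)
  gmulA gmulC gmul1g gmulDl gone_neq0.

HB.instance Definition _ := GRing.ComNzRing_hasMulInverse.Build (galg B G)
  (@cinvV (galg B G)) (@cunitP (galg B G)) (@cinv_out (galg B G)).

Definition gconst (c : B) : galg B G := << c *g 0 >>.

Lemma gconst_additive : zmod_morphism gconst.
Proof. by move=> c d; rewrite /gconst monalgUB. Qed.

Lemma gconst_monoid : monoid_morphism gconst.
Proof. by split=> // c d; rewrite [RHS]gmulUU addr0. Qed.

HB.instance Definition _ :=
  GRing.isZmodMorphism.Build B (galg B G) gconst gconst_additive.
HB.instance Definition _ :=
  GRing.isMonoidMorphism.Build B (galg B G) gconst gconst_monoid.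

Lemma galgM f g : f * g = gmul f g. Proof. by []. Qed.

Lemma gmul_coef f g k :
  (f * g)@_k = \sum_(i <- msupp f) \sum_(j <- msupp g)
                 f@_i * g@_j *+ (i + j == k).
Proof.
rewrite galgM raddf_sum; apply: eq_bigr => i _.
by rewrite raddf_sum; apply: eq_bigr => j _; rewrite /= mcoeffU.
Qed.

End GroupAlgebra.

(* B[Z^n] is a domain when B is: compare the lexicographically largest
    exponents. *)
Section Lex.
Context (n : nat).
Implicit Types u v w : 'rV[int]_n.

Definition lexlt u v : Prop :=
  exists i, u 0 i < v 0 i /\ forall j : 'I_n, (j < i)%N -> u 0 j = v 0 j.

Lemma lexlt_trans u v w : lexlt u v -> lexlt v w -> lexlt u w.
Proof.
move=> [i [ui eqi]] [j [vj eqj]].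
case: (ltngtP i j) => [ij|ji|/val_inj ij].
- exists i; split; first by rewrite -(eqj i ij).
  by move=> k ki; rewrite eqi// eqj// (ltn_trans ki).
- exists j; split; first by rewrite (eqi j ji).
  by move=> k kj; rewrite eqi ?eqj// (ltn_trans kj).
- subst j; exists i; split; first exact: lt_trans ui vj.
  by move=> k ki; rewrite eqi ?eqj.
Qed.

Lemma lexlt_irr u : ~ lexlt u u.
Proof. by case=> i [+ _]; rewrite ltxx. Qed.

Lemma lexlt_add2r w u v : lexlt u v -> lexlt (u + w) (v + w).
Proof.
move=> [i [ui eqi]]; exists i; split=> [|j ji]; rewrite !mxE ?ltrD2r//.
by rewrite eqi.
Qed.

Lemma lexlt_total u v : u != v -> lexlt u v \/ lexlt v u.
Proof.
move=> uv; have [i0 i0P] : exists i, u 0 i != v 0 i.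
  apply/existsP; apply: contraR uv => /existsPn uv.
  by apply/eqP/rowP => i; apply/eqP; move: (uv i); rewrite negbK.
case: (@arg_minnP _ i0 (fun i => u 0 i != v 0 i) (@nat_of_ord n) i0P) => i iP imin.
have E (j : 'I_n) : (j < i)%N -> u 0 j = v 0 j.
  by move=> ji; apply/eqP; apply: contraTT ji => /imin; rewrite -leqNgt.
case: (ltgtP (u 0 i) (v 0 i)) iP => // H _; [left|right]; exists i; split=> //.
by move=> j ji; rewrite E.
Qed.

Lemma lexlt_max (s : seq 'rV[int]_n) : s != [::] ->
  exists2 u, u \in s & forall v, v \in s -> v != u -> lexlt v u.
Proof.
elim: s => // a s IH _; case: (eqVneq s [::]) => [->|/IH[u us umax]].
  by exists a; rewrite ?mem_head// => v; rewrite inE => /eqP->; rewrite eqxx.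
case: (eqVneq a u) => [->|au].
  exists u; rewrite ?mem_head// => v; rewrite inE => /orP[/eqP->|/umax//].
  by rewrite eqxx.
case: (lexlt_total au) => [lau|lua].
  exists u; first by rewrite inE us orbT.
  by move=> v; rewrite inE => /orP[/eqP->//|/umax].
exists a; rewrite ?mem_head// => v; rewrite inE => /orP[/eqP->|vs _].
  by rewrite eqxx.
by case: (eqVneq v u) => [->//|/(umax _ vs)/lexlt_trans]; apply.
Qed.

End Lex.

Notation "'laurent' n B" := (galg B 'rV[int]_n)
  (at level 10, n at level 8, B at level 8).

Section LaurentDomain.
Context (B : idomainType) (n : nat).

Lemma laurent_lead (f : laurent n B) : f != 0 -> exists2 u, u \in msupp f &
  forall v, v \in msupp f -> v != u -> lexlt v u.
Proof.
move=> f0; apply: lexlt_max; apply: contra f0 => /eqP f0.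
rewrite [f]monalgE big_seq big1// => k; by rewrite f0.
Qed.

Lemma laurent_idomain : GRing.integral_domain_axiom (laurent n B).
Proof.
move=> f g fg0; apply/norP => -[/laurent_lead[u uf umax]].
move=> /laurent_lead[v vg vmax].
have : (f * g)@_(u + v) != 0.
  rewrite gmul_coef (big_fsetD1 u)//= (big_fsetD1 v)//= eqxx mulr1n.
  rewrite [X in _ + X + _]big_seq big1 ?addr0; last first.
    move=> j; rewrite in_fsetD1 => /andP[jv _].
    by rewrite (inj_eq (addrI u)) (negbTE jv).
  rewrite [X in _ + X]big_seq big1 ?addr0.
    by rewrite mulf_neq0// mcoeff_neq0.
  move=> i; rewrite in_fsetD1 => /andP[iu ifs].
  rewrite big_seq big1// => j jg; case: eqP => // E; exfalso.
  have iul := umax _ ifs iu.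
  have L : lexlt (i + j) (u + j) by exact: lexlt_add2r.
  case: (eqVneq j v) => [jv|/(vmax _ jg) jvl].
    by move: L; rewrite E jv => /lexlt_irr.
  have := lexlt_trans L (_ : lexlt (u + j) (u + v)).
  rewrite E => /(_ _)/lexlt_irr; apply.
  by rewrite !(addrC u); exact: lexlt_add2r.
by rewrite fg0 mcoeff0 eqxx.
Qed.

HB.instance Definition _ :=
  GRing.ComUnitRing_isIntegral.Build (laurent n B) laurent_idomain.

End LaurentDomain.

Section Schemes.
Context (R : realType) (K : fieldType) (iota : {rmorphism R[i] -> K}).

Record calg := Calg {
  car :> set K;
  car_const : forall z, car (iota z);
  carD : forall f g, car f -> car g -> car (f + g);
  carM : forall f g, car f -> car g -> car (f * g) }.

Definition generated (S : set K) : set K :=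
  [set f | forall A : calg, S `<=` A -> car A f].

Definition finitely_generated (A : calg) :=
  exists s : seq K, A = generated [set` s] :> set K.

Record prime_ideal (A : calg) (p : set K) : Prop := {
  prime_sub : p `<=` A;
  prime0 : p 0;
  prime1 : ~ p 1;
  primeD : forall a b, p a -> p b -> p (a + b);
  prime_absorb : forall a b, car A a -> p b -> p (a * b);
  prime_mul : forall a b, car A a -> car A b -> p (a * b) -> p a \/ p b }.

Definition localization_set (A : calg) (p : set K) : set K :=
  [set f | exists a b, [/\ car A a, car A b, ~ p b & f = a / b]].

Definition spec (A : calg) := {p : set K | prime_ideal A p}.

Lemma car0 (A : calg) : car A 0. Proof. by rewrite -(rmorph0 iota); exact: car_const. Qed.
Lemma car1 (A : calg) : car A 1. Proof. by rewrite -(rmorph1 iota); exact: car_const. Qed.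

HB.instance Definition _ (A : calg) := gen_eqMixin (spec A).
HB.instance Definition _ (A : calg) := gen_choiceMixin (spec A).

Section Spec.
Context (A : calg).

Definition spec_open (U : set (spec A)) :=
  exists2 I : set K, I `<=` A & U = [set p | ~ (I `<=` sval p)].

Lemma spec_openT : spec_open setT.
Proof.
exists [set 1]; first by move=> _ ->; exact: car1.
by apply/seteqP; split=> // p _ /(_ 1 erefl); exact: (prime1 (svalP p)).
Qed.

Lemma spec_openI : setI_closed spec_open.
Proof.
move=> _ _ [I IA ->] [J JA ->].
exists [set f | exists2 a, I a & exists2 b, J b & f = a * b].
  by move=> _ [a /IA aA [b /JA bA ->]]; exact: carM.
apply/seteqP; split=> p /=.
  move=> [/existsNP[a /not_implyP[Ia pa]] /existsNP[b /not_implyP[Jb pb]]] IJp.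
  have /(prime_mul (svalP p) (IA _ Ia) (JA _ Jb)) : sval p (a * b).
    by apply: IJp; exists a => //; exists b.
  by case.
move=> IJp; split=> [Ip|Jp]; apply: IJp => _ [a Ia [b Jb ->]].
  by rewrite mulrC; exact: (prime_absorb (svalP p) (JA _ Jb) (Ip _ Ia)).
exact: (prime_absorb (svalP p) (IA _ Ia) (Jp _ Jb)).
Qed.

Lemma spec_open_bigU (T : Type) (F : T -> set (spec A)) :
  (forall i, spec_open (F i)) -> spec_open (\bigcup_i F i).
Proof.
move=> Fo.
exists [set f | exists I : set K, [/\ I `<=` A, I f &
    exists i, F i = [set p : spec A | ~ (I `<=` sval p)]]].
  by move=> f [I [IA If _]]; exact: IA.
apply/seteqP; split=> p /=.
  move=> [i _ Fip] Hp; have [I IA E] := Fo i.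
  move: (Fip); rewrite E; apply=> f If.
  by apply: Hp; exists I; split=> //; exists i.
move=> /existsNP[f /not_implyP[[I [IA If [i E]]] pf]].
by exists i => //; rewrite E /= => Ip; exact/pf/Ip.
Qed.

HB.instance Definition _ := isOpenTopological.Build (spec A)
  spec_openT spec_openI spec_open_bigU.

Section Localization.
Context (p : spec A).
Let S := localization_set A (sval p).

Let nz (b : K) : ~ sval p b -> b != 0.
Proof. by move=> pb; apply/eqP => b0; apply: pb; rewrite b0; exact: (prime0 (svalP p)). Qed.

Let nmul (b d : K) : car A b -> car A d -> ~ sval p b -> ~ sval p d ->
  ~ sval p (b * d).
Proof. by move=> bA dA pb pd /(prime_mul (svalP p) bA dA)[]. Qed.

Let S_const z : S (iota z).
Proof.
exists (iota z), 1; split; [exact: car_const|exact: car1| |by rewrite divr1].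
exact: (prime1 (svalP p)).
Qed.

Let SD f g : S f -> S g -> S (f + g).
Proof.
move=> [a [b [aA bA pb ->]]] [c [d [cA dA pd ->]]].
exists (a * d + c * b), (b * d); split; [|exact: carM|exact: nmul|].
  by apply: carD; exact: carM.
by rewrite addf_div ?nz.
Qed.

Let SM f g : S f -> S g -> S (f * g).
Proof.
move=> [a [b [aA bA pb ->]]] [c [d [cA dA pd ->]]].
exists (a * c), (b * d); split; [exact: carM|exact: carM|exact: nmul|].
by rewrite mulf_div.
Qed.

Definition localization : calg := Calg S_const SD SM.

End Localization.
End Spec.

Record scheme_data := SchemeData {
  pt :> topologicalType;
  stalk : pt -> calg }.

Definition Spec (A : calg) : scheme_data := @SchemeData (spec A) (@localization A).

Section SpaceTheory.
Context (X : scheme_data).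
Implicit Types (U V Z W : set X) (x : X) (f g : K).

Definition sections U : calg.
Proof.
exists [set f | forall x, U x -> car (stalk x) f].
- by move=> z x _; exact: car_const.
- by move=> f g fU gU x Ux; apply: carD; [exact: fU|exact: gU].
- by move=> f g fU gU x Ux; apply: carM; [exact: fU|exact: gU].
Defined.

(* U is an open subscheme isomorphic to Spec O(U), with function field K. *)
Definition affine U :=
  [/\ open U,
      forall f, exists a b, [/\ car (sections U) a, car (sections U) b,
                                b != 0 & f = a / b] &
      exists phi : X -> Spec (sections U),
        [/\ set_bij U setT phi,
            forall V, V `<=` U -> (open V <-> open (phi @` V)) &
            forall x, U x -> stalk x = stalk (phi x) :> set K]].

Definition irreducible_set Z :=
  Z !=set0 /\ forall U V, open U -> open V ->
    Z `&` U !=set0 -> Z `&` V !=set0 -> Z `&` (U `&` V) !=set0.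

Definition integral_scheme :=
  irreducible_set setT /\ forall x, exists2 U, affine U & U x.

(* The diagonal is a closed immersion, read on the charts U * V of X * X. *)
Definition separated_scheme := forall U V, affine U -> affine V ->
  affine (U `&` V) /\
  sections (U `&` V) = generated (sections U `|` sections V) :> set K.

Definition finite_type := exists (k : nat) (U : 'I_k -> set X),
  (forall i, affine (U i) /\ finitely_generated (sections (U i))) /\
  (forall x, exists i, U i x).

Definition variety := [/\ integral_scheme, separated_scheme & finite_type].

Definition normal_scheme := forall x f (p : {poly K}), p \is monic ->
  (forall i, car (stalk x) p`_i) -> root p f -> car (stalk x) f.

(* The second part is a closed immersion X -> P^k over A0 = H^0(X, O), with
   homogeneous coordinates (f 0 : ... : f k): the preimage of the i-th standard
   chart of P^k consists of the points where f i generates the fractional ideal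
   of all the f j. *)
Definition semi_projective :=
  finitely_generated (sections setT) /\
  exists (k : nat) (f : 'I_k.+1 -> K),
    let chart i := [set x | forall j, car (stalk x) (f j / f i)] in
    (forall x, exists2 i, f i != 0 & chart i x) /\
    (forall i, f i != 0 -> affine (chart i) /\
       sections (chart i) =
         generated (sections setT `|` [set f j / f i | j in setT]) :> set K).

(* An involution of the scheme, with its comorphism on the function field. *)
Record Rstructure := {
  rs_pt : X -> X;
  rs_fun : {rmorphism K -> K};
  rs_ptK : involutive rs_pt;
  rs_funK : involutive rs_fun;
  rs_cont : continuous rs_pt;
  rs_conj : forall z, rs_fun (iota z) = iota z^*;
  rs_stalk : forall x f,
    car (stalk (rs_pt x)) f <-> car (stalk x) (rs_fun f) }.

Definition prime_divisor Z :=
  [/\ closed Z, irreducible_set Z, Z <> setT &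
      forall W, closed W -> irreducible_set W -> Z `<=` W -> W = Z \/ W = setT].

(* The local ring at the generic point of Z. *)
Definition local_ring Z : set K := [set f | exists2 x, Z x & car (stalk x) f].

Record normalized_valuation (O : set K) (v : K -> int) : Prop := {
  nv0 : v 0 = 0;
  nvM : forall f g, f != 0 -> g != 0 -> v (f * g) = v f + v g;
  nvD : forall f g, f != 0 -> g != 0 -> f + g != 0 ->
    Order.min (v f) (v g) <= v (f + g);
  nv_uniformizer : exists2 t, t != 0 & v t = 1;
  nv_ring : forall f, f != 0 -> (O f <-> 0 <= v f) }.

(* When X is a normal variety and Z a prime divisor, the local ring of Z is a
   discrete valuation ring and exactly one v qualifies. *)
Definition ord Z : K -> int :=
  xget (fun=> 0) [set v | normalized_valuation (local_ring Z) v].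

(* Only the values at prime divisors matter. *)
Definition Qdivisor := set X -> rat.
Implicit Types D : Qdivisor.

Definition eq_div D D' := forall Z, prime_divisor Z -> D Z = D' Z.
Definition div f : Qdivisor := fun Z => (ord Z f)%:~R.
Definition scale_div (k : nat) D : Qdivisor := fun Z => k%:R * D Z.
Definition pullback (sigma : Rstructure) D : Qdivisor :=
  fun Z => D (rs_pt sigma @` Z).

Definition H0 D : set K :=
  [set f | f = 0 \/ forall Z, prime_divisor Z -> 0 <= div f Z + D Z].

Definition cartier D := forall x, exists U g, [/\ open U, U x, g != 0 &
  forall Z, prime_divisor Z -> Z `&` U !=set0 -> D Z = div g Z].

Definition Qcartier D := exists2 k : nat, (0 < k)%N & cartier (scale_div k D).

(* The complement of Supp (div f + D). *)
Definition nonvanishing D f : set X :=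
  [set x | forall Z, prime_divisor Z -> Z x -> div f Z + D Z = 0].

Definition semi_ample D := exists2 k : nat, (0 < k)%N &
  forall x, exists f, [/\ f != 0, H0 (scale_div k D) f &
                          nonvanishing (scale_div k D) f x].

Definition big D := exists2 k : nat, (0 < k)%N &
  exists f, [/\ f != 0, H0 (scale_div k D) f &
                affine (nonvanishing (scale_div k D) f)].

(* ord Z is either a valuation or, if there is none, 0. *)
Lemma ordM Z f g : f != 0 -> g != 0 -> ord Z (f * g) = ord Z f + ord Z g.
Proof.
move=> f0 g0; rewrite /ord; case: xgetP => [v _ vP|_]; last by rewrite addr0.
exact: (nvM vP).
Qed.

Lemma ordD Z f g : f != 0 -> g != 0 -> f + g != 0 ->
  Order.min (ord Z f) (ord Z g) <= ord Z (f + g).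
Proof.
move=> f0 g0 fg0; rewrite /ord; case: xgetP => [v _ vP|_]; last by rewrite minxx.
exact: (nvD vP).
Qed.

Lemma ord_const Z z : Z !=set0 -> 0 <= ord Z (iota z).
Proof.
move=> [x Zx]; rewrite /ord; case: xgetP => [v _ vP|//].
have [->|iz0] := eqVneq (iota z) 0; first by rewrite (nv0 vP).
by apply/(nv_ring vP iz0); exists x => //; exact: car_const.
Qed.

Lemma H0D D f g : H0 D f -> H0 D g -> H0 D (f + g).
Proof.
move=> [->|Df]; first by rewrite add0r.
move=> [->|Dg]; first by rewrite addr0; right.
have [->|f0] := eqVneq f 0; first by rewrite add0r; right.
have [->|g0] := eqVneq g 0; first by rewrite addr0; right.
have [->|fg0] := eqVneq (f + g) 0; first by left.
right=> Z PZ; have := ordD Z f0 g0 fg0; rewrite ge_min => /orP[] H.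
  by apply: le_trans (Df _ PZ) _; rewrite lerD2r ler_int.
by apply: le_trans (Dg _ PZ) _; rewrite lerD2r ler_int.
Qed.

Lemma H0M D D' E f g :
  (forall Z, prime_divisor Z -> D Z + D' Z <= E Z) ->
  H0 D f -> H0 D' g -> H0 E (f * g).
Proof.
move=> DE [->|Df]; first by rewrite mul0r; left.
move=> [->|Dg]; first by rewrite mulr0; left.
have [->|f0] := eqVneq f 0; first by rewrite mul0r; left.
have [->|g0] := eqVneq g 0; first by rewrite mulr0; left.
right=> Z PZ; rewrite /div ordM// rmorphD /=.
apply: le_trans (addr_ge0 (Df _ PZ) (Dg _ PZ)) _.
by rewrite addrACA lerD2l DE.
Qed.

Lemma H0_const D z :
  (forall Z, prime_divisor Z -> 0 <= D Z) -> H0 D (iota z).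
Proof.
move=> D0; right=> Z PZ; rewrite addr_ge0 ?D0// ler0z.
by case: PZ => _ [Z0 _] _ _; exact: ord_const.
Qed.

End SpaceTheory.
End Schemes.

Section SpecDomain.
Context (R : realType) (B : idomainType) (c : {rmorphism R[i] -> B}).

Definition frac_const : {rmorphism R[i] -> {fraction B}} := @tofrac B \o c.

Definition domain_calg : calg frac_const.
Proof.
exists (range (@tofrac B)).
- by move=> z; exists (c z).
- by move=> _ _ [a _ <-] [b _ <-]; exists (a + b); rewrite ?rmorphD.
- by move=> _ _ [a _ <-] [b _ <-]; exists (a * b); rewrite ?rmorphM.
Defined.

Definition SpecD : scheme_data frac_const := Spec domain_calg.

(* The comorphism of an involution of Spec B on global sections. *)
Definition comorphism (sigma : Rstructure SpecD) (b : B) : B :=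
  xget 0 [set b' | tofrac b' = rs_fun sigma (tofrac b)].

End SpecDomain.

Section Tori.
Context (R : realType) (n : nat).

(* C[M] for M = Z^n; [chi m] is the character m of the torus Spec C[M], and the
   coordinate ring of the product of Spec B and the torus is B[M]. *)
Definition torus_ring := laurent n R[i].
HB.instance Definition _ := GRing.IntegralDomain.on torus_ring.

Definition torus_const : {rmorphism R[i] -> torus_ring} :=
  @gconst R[i] 'rV[int]_n.
Definition chi (m : 'rV[int]_n) : torus_ring := << 1 *g m >>.

Definition torus : scheme_data (frac_const torus_const) := SpecD torus_const.

(* Comorphisms of the group law of the torus: comul, with values in
   C[M][M] = C[M] (x) C[M], of the product. *)
Definition comul (f : torus_ring) : laurent n torus_ring :=
  \sum_(m <- msupp f) << (<< f@_m *g m >> : torus_ring) *g m >>.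
Definition antipode (f : torus_ring) : torus_ring :=
  \sum_(m <- msupp f) << f@_m *g - m >>.
Definition counit (f : torus_ring) : R[i] := \sum_(m <- msupp f) f@_m.

(* For antilinear s : B -> B and t : C[M] -> C[M], the map s (x) t on
   B[M] = B (x)_C C[M]. *)
Definition tensor (B : comNzRingType) (c : R[i] -> B) (s : B -> B)
    (t : torus_ring -> torus_ring) (g : laurent n B) : laurent n B :=
  \sum_(m <- msupp g) \sum_(l <- msupp (t (chi m)))
     << s g@_m * c (t (chi m))@_l *g l >>.

(* The product, the inverse and the unit of the torus commute with tau; the real
   structure of the point Spec C is complex conjugation. *)
Record real_torus := {
  tau :> Rstructure torus;
  tau_mul : forall f,
    comul (comorphism tau f) =
    tensor torus_const (comorphism tau) (comorphism tau) (comul f);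
  tau_inv : forall f,
    comorphism tau (antipode f) = antipode (comorphism tau f);
  tau_unit : forall f, counit (comorphism tau f) = (counit f)^* }.

(* The involution of M with tau^# (chi m) = chi (tilde m). *)
Definition tilde (t : real_torus) (m : 'rV[int]_n) : 'rV[int]_n :=
  xget 0 [set m' | comorphism t (chi m) = chi m'].

End Tori.

Section Cones.
Context (n : nat).
Local Notation MQ := 'rV[rat]_n.
Local Notation NQ := 'cV[rat]_n.

Definition emb (m : 'rV[int]_n) : MQ := map_mx intr m.

Definition pairing (u : MQ) (v : NQ) : rat := (u *m v) 0 0.

Definition linear_extension (t : 'rV[int]_n -> 'rV[int]_n) (u : MQ) : MQ :=
  \sum_i u 0 i *: emb (t (delta_mx 0 i)).

(* M_Q consists of rows and N_Q of columns. *)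
Record cone := Cone {
  cone_set :> set MQ;
  cone_fg : exists (k : nat) (G : 'M[rat]_(k, n)), cone_set =
    [set u | exists2 a : 'rV[rat]_k, (forall i, 0 <= a 0 i) & u = a *m G] }.

Definition dual (w : set MQ) : set NQ :=
  [set v | forall u, w u -> 0 <= pairing u v].

Definition linear_span (S : set MQ) : set MQ :=
  [set u | exists (k : nat) (A : 'M[rat]_(k, n)),
     (forall i, S (row i A)) /\ (u <= A)%MS].

Definition full_dimensional (w : cone) := linear_span w = setT.

(* The interior in the linear span, which is the affine hull of a cone. *)
Definition relint (w : cone) : set MQ :=
  [set u | cone_set w u /\ exists2 e : rat, 0 < e &
     forall u', linear_span w u' -> (forall i, `|u' 0 i - u 0 i| < e) ->
       cone_set w u'].

(* Convex hull of finitely many points plus the tail cone. *)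
Definition tailed_polyhedron (tail : set NQ) (Delta : set NQ) :=
  exists (k : nat) (P : 'M[rat]_(n, k.+1)),
    Delta = [set v | exists (a : 'cV[rat]_k.+1) (w : NQ),
      [/\ forall i, 0 <= a i 0, \sum_i a i 0 = 1, tail w & v = P *m a + w]].

Definition is_min (u : MQ) (Delta : set NQ) (q : rat) :=
  (exists2 v, Delta v & q = pairing u v) /\
  (forall v, Delta v -> q <= pairing u v).

Definition min_pairing (u : MQ) (Delta : set NQ) : rat :=
  xget 0 [set q | is_min u Delta q].

Lemma embD m m' : emb (m + m') = emb m + emb m'.
Proof. by rewrite /emb map_mxD. Qed.

Lemma emb0 : emb 0 = 0.
Proof. by rewrite /emb map_mx0. Qed.

Lemma pairingDl u u' v : pairing (u + u') v = pairing u v + pairing u' v.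
Proof. by rewrite /pairing mulmxDl mxE. Qed.

Lemma pairing0l v : pairing 0 v = 0.
Proof. by rewrite /pairing mul0mx mxE. Qed.

Lemma cone0 (w : cone) : cone_set w 0.
Proof.
case: (cone_fg w) => k [G ->]; exists 0; last by rewrite mul0mx.
by move=> i; rewrite mxE.
Qed.

Lemma coneD (w : cone) u u' :
  cone_set w u -> cone_set w u' -> cone_set w (u + u').
Proof.
case: (cone_fg w) => k [G ->] [a a0 ->] [b b0 ->]; exists (a + b).
  by move=> i; rewrite mxE addr_ge0.
by rewrite mulmxDl.
Qed.

Lemma min_pairingP (w : cone) u Delta : cone_set w u ->
  tailed_polyhedron (dual w) Delta -> is_min u Delta (min_pairing u Delta).
Proof.
move=> wu [k [P E]].
suff [q qP] : exists q, is_min u Delta q.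
  by rewrite /min_pairing; case: xgetP => // /(_ q).
case: (@arg_minP _ _ _ (ord0 : 'I_k.+1) xpredT
  (fun i => pairing u (col i P)) isT) => i _ imin.
exists (pairing u (col i P)); split.
  exists (col i P) => //; rewrite E; exists (delta_mx i 0), 0; split.
  - by move=> j; rewrite mxE; case: (_ && _).
  - rewrite (bigD1 i)//= big1 ?addr0; first by rewrite mxE !eqxx.
    by move=> j ji; rewrite mxE (negbTE ji).
  - by move=> u' _; rewrite /pairing mulmx0 mxE.
  - by rewrite -colE addr0.
rewrite E => _ [a [v [a0 a1 vw ->]]].
have -> : pairing u (P *m a + v) =
    \sum_j pairing u (col j P) * a j 0 + pairing u v.
  rewrite /pairing mulmxDr mxE mulmxA [X in X + _]mxE; congr (_ + _).
  by apply: eq_bigr => j _; rewrite colE mulmxA -colE [in RHS]mxE.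
rewrite -[leLHS]addr0 lerD ?vw// -[leLHS]mulr1 -a1 mulr_sumr.
by apply: ler_sum => j _; rewrite ler_wpM2r// imin.
Qed.

End Cones.

Section PolyhedralDivisors.
Context (R : realType) (K : fieldType) (iota : {rmorphism R[i] -> K}).
Context (Y : scheme_data iota) (n : nat) (omega : cone n).

(* The tail cone is [dual omega]; only the coefficients of prime divisors
   matter. *)
Record polyhedral_divisor := {
  coefficient : set Y -> set 'cV[rat]_n;
  coefficientP : forall Z, prime_divisor Z ->
    tailed_polyhedron (dual omega) (coefficient Z);
  coefficient_fin : finite_set
    [set Z | prime_divisor Z /\ coefficient Z <> dual omega] }.

Definition evaluation (D : polyhedral_divisor) (m : 'rV[int]_n) : Qdivisor Y :=
  fun Z => min_pairing (emb m) (coefficient D Z).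

Definition proper_divisor (D : polyhedral_divisor) :=
  (forall m, cone_set omega (emb m) ->
     Qcartier (evaluation D m) /\ semi_ample (evaluation D m)) /\
  (forall m, relint omega (emb m) -> big (evaluation D m)).

Section SectionRing.
Context (D : polyhedral_divisor).

Definition piece (m : 'rV[int]_n) : set K :=
  [set f | f = 0 \/ cone_set omega (emb m) /\ H0 (evaluation D m) f].

(* A[Y, D] is the subring AD of K[M]. *)
Definition AD_pred : {pred laurent n K} :=
  fun a => `[< forall m, piece m a@_m >].

Record AD := MkAD { AD_val : laurent n K; AD_valP : AD_val \in AD_pred }.

Lemma evaluationD m m' Z : cone_set omega (emb m) ->
  cone_set omega (emb m') -> prime_divisor Z ->
  evaluation D m Z + evaluation D m' Z <= evaluation D (m + m') Z.
Proof.
move=> om om' PZ; have DP := coefficientP D PZ.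
have omm : cone_set omega (emb (m + m')) by rewrite embD; exact: coneD.
have [[v Dv Ev] _] := min_pairingP omm DP.
rewrite [leRHS]Ev embD pairingDl; apply: lerD.
  by case: (min_pairingP om DP) => _; exact.
by case: (min_pairingP om' DP) => _; exact.
Qed.

Lemma pieceD m f g : piece m f -> piece m g -> piece m (f + g).
Proof.
move=> [->|[om Df]]; first by rewrite add0r.
move=> [->|[_ Dg]]; first by rewrite addr0; right.
by right; split=> //; exact: H0D.
Qed.

Lemma pieceM m m' f g : piece m f -> piece m' g -> piece (m + m') (f * g).
Proof.
move=> [->|[om Df]]; first by rewrite mul0r; left.
move=> [->|[om' Dg]]; first by rewrite mulr0; left.
right; split; first by rewrite embD; exact: coneD.
by apply: H0M Df Dg => Z PZ; exact: evaluationD.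
Qed.

Lemma piece_const z : piece 0 (iota z).
Proof.
right; split; first by rewrite emb0; exact: cone0.
apply: H0_const => Z PZ.
have om0 : cone_set omega (emb 0) by rewrite emb0; exact: cone0.
have [[v _ E] _] := min_pairingP om0 (coefficientP D PZ).
by rewrite /evaluation E emb0 pairing0l.
Qed.

Lemma AD_predP a : reflect (forall m, piece m a@_m) (a \in AD_pred).
Proof. exact: asboolP. Qed.

Lemma AD_mono m f : piece m f -> (<< f *g m >> : laurent n K) \in AD_pred.
Proof.
move=> mf; apply/AD_predP => k; rewrite mcoeffU.
by case: eqP => [<-|_]; rewrite ?mulr1n ?mulr0n//; left.
Qed.

Lemma AD_const z : gconst 'rV[int]_n (iota z) \in AD_pred.
Proof. exact/AD_mono/piece_const. Qed.

Lemma piece_sum (I : eqType) (r : seq I) (F : I -> K) m :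
  (forall i, i \in r -> piece m (F i)) -> piece m (\sum_(i <- r) F i).
Proof.
move=> FP; rewrite big_seq; apply: (big_ind (piece m)) => //; first by left.
by move=> ? ?; exact: pieceD.
Qed.

Lemma AD_M : {in AD_pred &, forall a b, a * b \in AD_pred}.
Proof.
move=> a b /AD_predP aA /AD_predP bA; apply/AD_predP => m.
rewrite gmul_coef; apply: piece_sum => i _; apply: piece_sum => j _.
by case: eqP => [<-|_]; rewrite ?mulr1n ?mulr0n; [exact: pieceM|left].
Qed.

Lemma AD_subring : subring_closed AD_pred.
Proof.
have A1 : 1 \in AD_pred by have := AD_const 1; rewrite rmorph1.
split=> //; last exact: AD_M.
move=> a b /AD_predP aA bA; apply/AD_predP => m.
have : (gconst 'rV[int]_n (iota (-1)) * b) \in AD_pred.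
  exact: AD_M (AD_const (-1)) bA.
rewrite !rmorphN1 mulN1r => /AD_predP/(_ m); rewrite mcoeffD mcoeffN.
by move=> Nb; exact: pieceD.
Qed.

HB.instance Definition _ :=
  GRing.isSubringClosed.Build (laurent n K) AD_pred AD_subring.
HB.instance Definition _ := [isSub for AD_val].
HB.instance Definition _ := [Choice of AD by <:].
HB.instance Definition _ := [SubChoice_isSubComNzRing of AD by <:].
HB.instance Definition _ := GRing.ComNzRing_hasMulInverse.Build AD
  (@cinvV AD) (@cunitP AD) (@cinv_out AD).

Lemma AD_idomain : GRing.integral_domain_axiom AD.
Proof.
move=> a b /(congr1 val)/eqP; rewrite rmorphM rmorph0 mulf_eq0.
by rewrite -!(rmorph0 (val : {rmorphism AD -> _})) !(inj_eq val_inj).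
Qed.

HB.instance Definition _ := GRing.ComUnitRing_isIntegral.Build AD AD_idomain.

Definition AD_of_const (z : R[i]) : AD := MkAD (AD_const z).

Lemma AD_of_const_additive : zmod_morphism AD_of_const.
Proof. by move=> z w; apply: val_inj; rewrite /= !rmorphB. Qed.

Lemma AD_of_const_monoid : monoid_morphism AD_of_const.
Proof.
by split=> [|z w]; apply: val_inj; rewrite /= ?rmorph1 ?rmorphM.
Qed.

HB.instance Definition _ :=
  GRing.isZmodMorphism.Build R[i] AD AD_of_const AD_of_const_additive.
HB.instance Definition _ :=
  GRing.isMonoidMorphism.Build R[i] AD AD_of_const AD_of_const_monoid.

Definition XD : scheme_data (frac_const AD_of_const) := SpecD AD_of_const.

Definition homogeneous_component (a : AD) (m : 'rV[int]_n) : AD :=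
  MkAD (AD_mono (elimT (AD_predP (AD_val a)) (AD_valP a) m)).

(* The comorphism A -> A[M] of the action of the torus on X[Y, D] defined by
   the grading: a |-> sum of a_m chi^m. *)
Definition coaction (a : AD) : laurent n AD :=
  \sum_(m <- msupp (AD_val a)) << homogeneous_component a m *g m >>.

(* sigma \o mu = mu \o (tau * sigma) *)
Definition real_torus_acts (t : real_torus R n) (sigma : Rstructure XD) :=
  forall a, coaction (comorphism sigma a) =
    tensor AD_of_const (comorphism sigma) (comorphism t) (coaction a).

End SectionRing.
End PolyhedralDivisors.

(* Main.v *)
Require Import Defs.
From HB Require Import structures.
From mathcomp Require Import all_boot all_order all_algebra fraction.
From mathcomp Require Import boolp classical_sets functions cardinality reals.
From mathcomp Require Import topology complex.
From mathcomp Require Import generic_quotient finmap monalg.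
Set Implicit Arguments.
Unset Strict Implicit.
Unset Printing Implicit Defensive.
Import Order.TTheory GRing.Theory Num.Theory.
Local Open Scope classical_set_scope.
Local Open Scope ring_scope.

(** The real structure on [XD D] is the one whose comorphism on [A[Y, D]] is
    the antilinear map
      f X_m |-> sigmaY^#(f) h(tilde m) X_(tilde m).

    It is well defined: for [f] in H^0(Y, D(m)), pulling the inequality
    div f + D(m) >= 0 back by [sigmaY] gives
      div (sigmaY^# f) + D(tilde m) + div (h (tilde m)) >= 0,
    so that [sigmaY^# f * h (tilde m)] lies in H^0(Y, D(tilde m)).  This is
    [H0_pullback]; it rests on the formula [ord_image], the compatibility of
    the orders of vanishing with the automorphism [sigmaY], which holds because
    a discrete valuation ring has only one normalized valuation
    ([normalized_valuation_inj]).

    It is a ring morphism because [h] is multiplicative on the cone and [tilde]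
    is additive, and an involution because h(m) sigmaY^#(h(tilde m)) = 1.  Both
    facts use that the comorphism of the torus involution permutes the
    characters ([comorphism_chi]): as [tau] is a group morphism, the image of a
    character is again group-like, hence a character.

    An antilinear involution of a domain [B] is the comorphism of a real
    structure on Spec B: extend it to the fraction field, and move prime ideals
    by preimage ([Spec_involution]).

    Finally the action is defined over the reals because the comorphism sends
    the component of weight [m] to the component of weight [tilde m], and the
    comorphism of [tau] does the same to the characters
    ([coaction_AD_conj]). *)

(** * Extending a ring morphism to the field of fractions *)

Section FractionLift.
Context (A : idomainType) (F : fieldType) (f : {rmorphism A -> F}).

Lemma fraction_eq_div (x : {fraction A}) :
  exists n d : A, d != 0 /\ x = tofrac n / tofrac d.
Proof.
elim/quotW: x => r; exists (\n_r), (\d_r); split; first exact: denom_ratioP.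
apply: (mulIf (x := tofrac \d_r)); first by rewrite tofrac_eq0 denom_ratioP.
rewrite divfK ?tofrac_eq0 ?denom_ratioP// /tofrac.
unlock FracField.tofrac; rewrite -[LHS]FracField.pi_mul.
apply/eqmodP; rewrite /= FracField.equivfE /FracField.mulf.
by rewrite !numden_Ratio ?mulf_neq0 ?oner_neq0 ?denom_ratioP// !mulr1 mulrC.
Qed.

(** The value n / d |-> f n / f d is described by a functional relation, so that
    all the morphism identities follow from its independence of the choice of
    numerator and denominator. *)
Lemma fraction_lift : injective f ->
  exists g : {rmorphism {fraction A} -> F}, forall a, g (tofrac a) = f a.
Proof.
move=> finj.
have f_neq0 d : d != 0 -> f d != 0 by rewrite -(inj_eq finj) rmorph0.
pose rel x y := exists n d, [/\ d != 0, x = tofrac n / tofrac d & y = f n / f d].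
have rel_ex x : exists y, rel x y.
  by have [n [d [d0 ->]]] := fraction_eq_div x; exists (f n / f d), n, d.
have rel_uniq x y y' : rel x y -> rel x y' -> y = y'.
  move=> [n [d [d0 -> ->]]] [n' [d' [d0' + ->]]].
  move=> /eqP; rewrite eqr_div ?tofrac_eq0// -!rmorphM tofrac_eq => /eqP E.
  by apply/eqP; rewrite eqr_div ?f_neq0// -!rmorphM E.
have [g gP] := choice rel_ex.
have gE x y : rel x y -> g x = y by move=> xy; apply: rel_uniq (gP x) xy.
have g_add : zmod_morphism g.
  move=> x y; have [n [d [d0 -> ->]]] := gP x.
  have [n' [d' [d0' -> ->]]] := gP y; apply: gE.
  exists (n * d' - n' * d), (d * d'); split; first exact: mulf_neq0.
    by rewrite -mulNr addf_div ?tofrac_eq0// mulNr !rmorphB !rmorphM.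
  by rewrite -mulNr addf_div ?f_neq0// mulNr !rmorphB !rmorphM.
have g_mul : monoid_morphism g.
  split=> [|x y].
    by apply: gE; exists 1, 1; rewrite oner_neq0 !rmorph1 !divr1.
  have [n [d [d0 -> ->]]] := gP x; have [n' [d' [d0' -> ->]]] := gP y.
  apply: gE; exists (n * n'), (d * d'); split; first exact: mulf_neq0.
    by rewrite mulf_div !rmorphM.
  by rewrite mulf_div !rmorphM.
pose gzM := GRing.isZmodMorphism.Build _ _ g g_add.
pose gmM := GRing.isMonoidMorphism.Build _ _ g g_mul.
pose gR : {rmorphism {fraction A} -> F} := HB.pack g gzM gmM.
exists gR => a; apply: gE; exists a, 1.
by rewrite oner_neq0 !rmorph1 !divr1.
Qed.

End FractionLift.

(** * Real structures on the spectrum of a domain *)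

Section SpecInvolution.
Context (R : realType) (B : idomainType) (c : {rmorphism R[i] -> B}).
Context (s : {rmorphism B -> B}).
Hypotheses (sK : involutive s) (s_conj : forall z, s (c z) = c z^*).

Lemma involution_fraction : exists g : {rmorphism {fraction B} -> {fraction B}},
  involutive g /\ forall b, g (tofrac b) = tofrac (s b).
Proof.
have [|g gE] := @fraction_lift _ _ (@tofrac B \o s).
  by move=> a b /eqP; rewrite tofrac_eq => /eqP/(inv_inj sK).
have gsE b : g (tofrac b) = tofrac (s b) by exact: gE.
exists g; split=> // x; have [n [d [d0 ->]]] := fraction_eq_div x.
by rewrite !fmorph_div !gsE !sK.
Qed.

Lemma domain_calg_stable (g : {rmorphism {fraction B} -> {fraction B}}) :
  (forall b, g (tofrac b) = tofrac (s b)) ->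
  forall f, car (domain_calg c) f -> car (domain_calg c) (g f).
Proof. by move=> gE _ [a _ <-]; exists (s a). Qed.

Lemma preimage_prime_ideal (g : {rmorphism {fraction B} -> {fraction B}}) :
  involutive g -> (forall f, car (domain_calg c) f -> car (domain_calg c) (g f)) ->
  forall p, prime_ideal (domain_calg c) p ->
    prime_ideal (domain_calg c) (g @^-1` p).
Proof.
move=> gK gA p pP; split=> /=.
- by move=> f /(prime_sub pP)/gA; rewrite gK.
- by rewrite rmorph0; exact: prime0 pP.
- by rewrite rmorph1; exact: prime1 pP.
- by move=> a b; rewrite rmorphD; exact: primeD pP _ _.
- by move=> a b /gA aA; rewrite rmorphM; exact: prime_absorb pP _ _ aA.
- by move=> a b /gA aA /gA bA; rewrite rmorphM; exact: prime_mul pP _ _ aA bA.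
Qed.

(** With [g] the extension of [s] to the fraction field, the preimage by [g]
    moves primes; the open set defined by [I] pulls back to the one defined by
    [g @` I], and a fraction a / b with b outside [g @^-1` p] goes to g a / g b
    with g b outside [p]. *)
Lemma Spec_involution :
  exists sigma : Rstructure (SpecD c), forall b, comorphism sigma b = s b.
Proof.
have [g [gK gE]] := involution_fraction.
have gA := domain_calg_stable gE.
pose pt (p : spec (domain_calg c)) : spec (domain_calg c) :=
  exist _ (g @^-1` sval p) (preimage_prime_ideal gK gA (svalP p)).
have ptK : involutive pt.
  by move=> [p pP]; apply: eq_exist => /=; apply/seteqP; split=> f /=; rewrite gK.
have pt_cont : continuous (pt : SpecD c -> SpecD c).
  apply/continuousP => _ [I IA ->]; exists (g @` I).
    by move=> _ [f /IA fA <-]; exact: (gA).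
  apply/seteqP; split=> p /= Ip; apply: contra_not Ip => Ip f.
    by move=> If; apply: Ip; exists f.
  by move=> [a Ia <-]; exact: Ip.
have loc p f : localization_set (domain_calg c) (g @^-1` p) f ->
    localization_set (domain_calg c) p (g f).
  move=> [a [b [aA bA bp ->]]].
  by exists (g a), (g b); split=> //; rewrite ?fmorph_div//; exact: (gA).
have pt_stalk p f : car (localization (pt p)) f <-> car (localization p) (g f).
  have gg : g @^-1` (g @^-1` sval p) = sval p.
    by apply/seteqP; split=> a /=; rewrite gK.
  split=> [|fp]; first exact: loc.
  by rewrite -[f]gK; apply: (loc (g @^-1` sval p)); rewrite gg.
have g_conj z : g (frac_const c z) = frac_const c z^*.
  by rewrite /frac_const /= gE s_conj.
exists (@Build_Rstructure _ _ _ (SpecD c) pt g ptK gK pt_cont g_conj pt_stalk).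
move=> b; rewrite /comorphism; case: xgetP => [b' _ /= /eqP|/(_ (s b))].
  by rewrite gE tofrac_eq => /eqP.
by rewrite /= gE; case.
Qed.

End SpecInvolution.

(** * Pullback of divisors by a real structure *)

Section PullbackDivisors.
Context (R : realType) (K : fieldType) (iota : {rmorphism R[i] -> K}).
Context (X : scheme_data iota).

(** [O] determines the sign of a valuation, hence its units; a uniformizer [t]
    for [v] writes every [f] as a unit times a power of [t], so that
    [w = w t * v], and a uniformizer for [w] forces the natural number [w t] to
    divide 1. *)
Lemma normalized_valuation_inj (O : set K) (v w : K -> int) :
  normalized_valuation O v -> normalized_valuation O w -> v = w.
Proof.
move=> vP wP; apply/funext => f.
have v1 u (uP : normalized_valuation O u) : u 1 = 0.
  by apply: (addrI (u 1)); rewrite -(nvM uP) ?oner_neq0// mulr1 addr0.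
have vV u (uP : normalized_valuation O u) g : g != 0 -> u g^-1 = - u g.
  move=> g0; apply: (addrI (u g)).
  by rewrite -(nvM uP) ?invr_eq0// divff// (v1 _ uP) subrr.
have vX u (uP : normalized_valuation O u) g (k : nat) : g != 0 ->
    u (g ^+ k) = u g *+ k.
  move=> g0; elim: k => [|k IH]; first by rewrite expr0 (v1 _ uP).
  by rewrite exprS (nvM uP) ?expf_neq0// IH mulrS.
have vZ u (uP : normalized_valuation O u) g (k : int) : g != 0 ->
    u (g ^ k) = u g * k.
  move=> g0; case: k => k; first by rewrite -exprnP (vX _ uP)// -mulr_natr natz.
  rewrite NegzE -exprnN (vV _ uP) ?expf_neq0// (vX _ uP)// mulrN.
  by rewrite -mulr_natr natz.
have nonneg_transfer u u' (uP : normalized_valuation O u)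
    (u'P : normalized_valuation O u') g : g != 0 -> 0 <= u g -> 0 <= u' g.
  by move=> g0 ug; apply/(nv_ring u'P g0)/(nv_ring uP g0).
have unit_transfer u u' (uP : normalized_valuation O u)
    (u'P : normalized_valuation O u') g : g != 0 -> u g = 0 -> u' g = 0.
  move=> g0 ug; apply/eqP.
  rewrite eq_le (nonneg_transfer _ _ uP u'P g)// ?ug// andbT.
  rewrite -oppr_ge0 -(vV _ u'P)// (nonneg_transfer _ _ uP u'P) ?invr_eq0//.
  by rewrite (vV _ uP)// ug oppr0.
(* [g * t ^ (- u g)] is a unit of [O], so that [u'] vanishes on it. *)
have proportional u u' (uP : normalized_valuation O u)
    (u'P : normalized_valuation O u') t g : t != 0 -> u t = 1 -> g != 0 -> u' g = u' t * u g.
  move=> t0 ut g0; apply/eqP; rewrite -subr_eq0 -mulrN -(vZ _ u'P)//.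
  rewrite -(nvM u'P) ?expfz_neq0//; apply/eqP.
  apply: (unit_transfer _ _ uP u'P); first by rewrite mulf_neq0 ?expfz_neq0.
  by rewrite (nvM uP) ?expfz_neq0// (vZ _ uP)// ut mul1r subrr.
have [->|f0] := eqVneq f 0; first by rewrite (nv0 vP) (nv0 wP).
have [t t0 vt] := nv_uniformizer vP; have [t' t'0 wt'] := nv_uniformizer wP.
have wt0 : 0 <= w t by rewrite (nonneg_transfer _ _ vP wP) ?vt.
have := proportional _ _ vP wP t t' t0 vt t'0; rewrite wt' => E.
have wt1 : w t = 1.
  have vt'0 : 0 <= v t' by rewrite (nonneg_transfer _ _ wP vP) ?wt'.
  move: E wt0 vt'0; case: (w t) => // a; case: (v t') => // b.
  by rewrite -PoszM => -[/esym/eqP]; rewrite muln_eq1 => /andP[/eqP->].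
by rewrite (proportional _ _ vP wP t)// wt1 mul1r.
Qed.

Lemma ordE Z v : normalized_valuation (local_ring Z) v -> @ord _ _ _ X Z = v.
Proof.
move=> vP; rewrite /ord; case: xgetP => [w _ wP|/(_ v)//].
exact: normalized_valuation_inj wP vP.
Qed.

Context (sigma : Rstructure X).
Local Notation sp := (rs_pt sigma).
Local Notation sf := (rs_fun sigma).

(** As [sp] is an involution, images are preimages; continuity then makes the
    image an operation on closed sets. *)
Lemma rs_imageE Z : sp @` Z = sp @^-1` Z.
Proof.
apply/seteqP; split=> [_ [x Zx <-]|x Zx] /=; first by rewrite rs_ptK.
by exists (sp x) => //; rewrite rs_ptK.
Qed.

Lemma rs_imageK : involutive (fun Z : set X => sp @` Z).
Proof.
by move=> Z; rewrite !rs_imageE; apply/seteqP; split=> x /=; rewrite rs_ptK.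
Qed.

Lemma rs_image_closed Z : closed Z -> closed (sp @` Z).
Proof.
move=> Zc; rewrite rs_imageE; apply: closed_comp => // x _; exact: rs_cont.
Qed.

Lemma rs_preimage_open U : open U -> open (sp @^-1` U).
Proof. by move=> Uo; move/continuousP: (@rs_cont _ _ _ _ sigma); exact. Qed.

Lemma rs_image_irreducible Z : irreducible_set Z -> irreducible_set (sp @` Z).
Proof.
move=> [[x Zx] Zirr]; split; first by exists (sp x), x.
move=> U V Uo Vo [_ [[y Zy <-] Uy]] [_ [[z Zz <-] Vz]].
have [||w [Zw [Uw Vw]]] :=
    Zirr _ _ (rs_preimage_open Uo) (rs_preimage_open Vo).
- by exists y.
- by exists z.
by exists (sp w); split=> //; exists w.
Qed.

Lemma rs_image_prime_divisor Z : prime_divisor Z -> prime_divisor (sp @` Z).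
Proof.
have fullT : sp @` setT = setT by rewrite rs_imageE.
move=> [Zc Zirr ZT Zmax]; split.
- exact: rs_image_closed.
- exact: rs_image_irreducible.
- by move=> E; apply: ZT; rewrite -[Z]rs_imageK /= E.
move=> W Wc Wirr /(image_subset sp); rewrite rs_imageK => ZW.
have [E|E] := Zmax _ (rs_image_closed Wc) (rs_image_irreducible Wirr) ZW.
  by left; rewrite -E rs_imageK.
by right; rewrite -[W]rs_imageK /= E.
Qed.

Lemma local_ring_image Z f : local_ring (sp @` Z) f <-> local_ring Z (sf f).
Proof.
split=> [[_ [x Zx <-] /rs_stalk fx]|[x Zx fx]]; first by exists x.
by exists (sp x); [exists x|apply/rs_stalk].
Qed.

Lemma normalized_valuation_image Z v :
  normalized_valuation (local_ring Z) v ->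
  normalized_valuation (local_ring (sp @` Z)) (v \o sf).
Proof.
move=> vP; split=> /=.
- by rewrite rmorph0 (nv0 vP).
- by move=> f g f0 g0; rewrite rmorphM (nvM vP) ?fmorph_eq0.
- move=> f g f0 g0 fg0; rewrite rmorphD.
  by apply: (nvD vP); rewrite -?rmorphD fmorph_eq0.
- have [t t0 vt] := nv_uniformizer vP.
  by exists (sf t); rewrite ?fmorph_eq0// rs_funK.
- move=> f f0; rewrite -(nv_ring vP) ?fmorph_eq0//; exact: local_ring_image.
Qed.

(** When the local ring at [Z] carries no valuation, neither does the one at the
    image of [Z], and both sides are 0 by convention. *)
Lemma ord_image Z f : ord (sp @` Z) f = ord Z (sf f).
Proof.
have [[v vP]|noZ] := pselect (exists v, normalized_valuation (local_ring Z) v).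
  by rewrite (ordE (normalized_valuation_image vP)) (ordE vP).
have noV v : ~ normalized_valuation (local_ring (sp @` Z)) v.
  move=> /normalized_valuation_image; rewrite rs_imageK => vP; apply: noZ.
  by exists (v \o sf).
rewrite /ord; case: xgetP => [v _ /noV//|_].
by case: xgetP => [v _ vP|//]; case: noZ; exists v.
Qed.

Lemma H0_pullback D E g f : g != 0 ->
  eq_div (pullback sigma D) (fun Z => E Z + div g Z) ->
  H0 D f -> H0 E (sf f * g).
Proof.
move=> g0 DE [->|Df]; first by left; rewrite rmorph0 mul0r.
have [->|f0] := eqVneq f 0; first by left; rewrite rmorph0 mul0r.
right=> Z PZ; have := Df _ (rs_image_prime_divisor PZ).
rewrite -/(pullback sigma D Z) DE// /div ord_image ordM ?fmorph_eq0//.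
by rewrite rmorphD -addrA [X in _ + X]addrC.
Qed.

End PullbackDivisors.

(** * The involution of the character lattice *)

(** An additive map of the lattice is determined by its values on the basis,
    which is how its rational extension is defined. *)
Lemma emb_additive (n : nat) (T : {additive 'rV[int]_n -> 'rV[int]_n}) m :
  emb (T m) = linear_extension T (emb m).
Proof.
rewrite [in LHS](row_sum_delta m) raddf_sum /linear_extension.
rewrite (big_morph _ (@embD n) (@emb0 n)); apply: eq_bigr => i _.
rewrite -[m 0 i in LHS]intz scaler_int raddfMz -scaler_int intz.
by apply/rowP => j; rewrite !mxE rmorphM.
Qed.

Lemma mcoeff_sumU (B : nzRingType) (G : choiceType) (d : {fset G})
    (F : G -> B) k : (forall m, m \notin d -> F m = 0) ->
  (\sum_(m <- d) << F m *g m >>)@_k = F k.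
Proof.
move=> Fd; rewrite raddf_sum /=.
have [kd|kd] := boolP (k \in d).
  rewrite (big_fsetD1 k)//= mcoeffUU big_seq big1 ?addr0// => m.
  by rewrite in_fsetD1 mcoeffU => /andP[/negbTE->].
rewrite Fd// big_seq big1// => m md; rewrite mcoeffU.
by case: eqP md kd => // -> ->.
Qed.

Section CharacterInvolution.
Context (R : realType) (n : nat) (t : real_torus R n).
Local Notation M := 'rV[int]_n.

Lemma chiD (m m' : M) : chi R (m + m') = chi R m * chi R m'.
Proof. by rewrite [RHS]gmulUU mulr1. Qed.

Lemma chi_inj : injective (@chi R n).
Proof.
move=> m m' /(congr1 (mcoeff m)); rewrite mcoeffUU mcoeffU.
by case: eqP => // _ /eqP; rewrite oner_eq0.
Qed.

Lemma msupp_chi (m : M) : msupp (chi R m) = [fset m]%fset.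
Proof. by rewrite msuppU oner_eq0. Qed.

(** The default value of [comorphism] is 0, so that a nonzero value is a genuine
    image under [rs_fun sigma]. *)
Lemma comorphism_spec (B : idomainType) (c : {rmorphism R[i] -> B})
    (sigma : Rstructure (SpecD c)) b : comorphism sigma b != 0 ->
  tofrac (comorphism sigma b) = rs_fun sigma (tofrac b).
Proof. by rewrite /comorphism; case: xgetP => // _; rewrite eqxx. Qed.

(** By compatibility of [tau] with the unit of the torus, the counit of the image
    is the conjugate of 1, while the counit of 0 is 0. *)
Lemma comorphism_chi_neq0 (m : M) : comorphism t (chi R m) != 0.
Proof.
apply/eqP => E; have := tau_unit t (chi R m); rewrite E /counit msupp0.
rewrite big_seq_fset0 msupp_chi big_seq_fset1 mcoeffUU rmorph1 => /esym/eqP.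
by rewrite oner_eq0.
Qed.

Lemma tensorU (B : comNzRingType) (c : R[i] -> B) (s : B -> B)
    (u : torus_ring R n -> torus_ring R n) b (m : M) : b != 0 ->
  tensor c s u << b *g m >> =
  \sum_(l <- msupp (u (chi R m))) << s b * c (u (chi R m))@_l *g l >>.
Proof. by move=> b0; rewrite /tensor msuppU (negbTE b0) big_seq_fset1 mcoeffUU. Qed.

Lemma comul_chi (m : M) : comul (chi R m) = << chi R m *g m >>.
Proof. by rewrite /comul msupp_chi big_seq_fset1 mcoeffUU. Qed.

Lemma chi_neq0 (m : M) : chi R m != 0.
Proof. by rewrite monalgU_eq0 oner_eq0. Qed.

(** Characters are the group-like elements of C[M].  Let [g] be the image of
    [chi m]; compatibility of [tau] with the group law gives
    comul g = g (x) g.  In degree [l] this reads g_l chi_l = g_l g, so that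
    [g = chi l] as soon as g_l is nonzero. *)
Lemma comorphism_chi (m : M) : comorphism t (chi R m) = chi R (tilde t m).
Proof.
rewrite /tilde; case: xgetP => [m' _ //|noM]; exfalso.
have := comorphism_chi_neq0 m; move: noM (tau_mul t (chi R m)).
rewrite comul_chi tensorU; last exact: chi_neq0.
move: (comorphism t (chi R m)) => g noM gmul g0.
have [l lg] : exists l, l \in msupp g.
  apply/fset0Pn; apply: contra g0 => /eqP g0; apply/eqP.
  by rewrite [g]monalgE g0 big_seq_fset0.
move/(congr1 (mcoeff l)): gmul.
rewrite [LHS]mcoeff_sumU; last first.
  by move=> k /mcoeff_outdom ->; rewrite monalgU0.
rewrite mcoeff_sumU; last first.
  by move=> k /mcoeff_outdom ->; rewrite rmorph0 mulr0.
have -> : << g@_l *g l >> = chi R l * torus_const R n g@_l :> torus_ring R n.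
  by rewrite [RHS]gmulUU mul1r addr0.
have gl0 : torus_const R n g@_l != 0.
  by rewrite [_ == _]monalgU_eq0 mcoeff_neq0.
by move=> E; apply: (noM l); exact: mulIf gl0 _ _ (esym E).
Qed.

Lemma rs_fun_chi (m : M) :
  rs_fun t (tofrac (chi R m)) = tofrac (chi R (tilde t m)).
Proof. by rewrite -comorphism_spec ?comorphism_chi_neq0// comorphism_chi. Qed.

Lemma tildeD : {morph tilde t : m m' / m + m'}.
Proof.
move=> m m'; apply: chi_inj; apply/eqP; rewrite -tofrac_eq -rs_fun_chi.
rewrite 2!chiD [X in rs_fun t X](tofracM (chi R m) (chi R m')).
rewrite (rmorphM (rs_fun t)) (rs_fun_chi m) (rs_fun_chi m').
exact/eqP/esym/tofracM.
Qed.

Lemma tildeK : involutive (tilde t).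
Proof.
move=> m; apply: chi_inj; apply/eqP.
by rewrite -tofrac_eq -(rs_fun_chi (tilde t m)) -(rs_fun_chi m) rs_funK.
Qed.

Lemma tilde0 : tilde t 0 = 0.
Proof. by apply: (addrI (tilde t 0)); rewrite -tildeD !addr0. Qed.

Lemma emb_tilde (m : M) : emb (tilde t m) = linear_extension (tilde t) (emb m).
Proof.
have tildeB : zmod_morphism (tilde t).
  by move=> x y; rewrite -[x in RHS](subrK y) (tildeD (x - y) y) addrK.
pose tildeM := GRing.isZmodMorphism.Build _ _ (tilde t) tildeB.
exact: (emb_additive (HB.pack (tilde t) tildeM)).
Qed.

Lemma tilde_cone (omega : cone n) :
  linear_extension (tilde t) @` cone_set omega = cone_set omega ->
  forall m, cone_set omega (emb m) -> cone_set omega (emb (tilde t m)).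
Proof. by move=> stable m om; rewrite emb_tilde -stable; exists (emb m). Qed.

End CharacterInvolution.

(** * Semilinear maps of group algebras *)

Section Twist.
Context (B : comNzRingType) (G : zmodType).
Context (s : {rmorphism B -> B}) (u : G -> G) (h : G -> B).

Definition twist (a : galg B G) : galg B G :=
  \sum_(m <- msupp a) << s a@_m * h (u m) *g u m >>.

Hypothesis uK : involutive u.

Lemma twistE a k : (twist a)@_k = s a@_(u k) * h k.
Proof.
have -> : (twist a)@_k =
    (\sum_(m <- msupp a) << s a@_m * h (u m) *g m >>)@_(u k).
  rewrite /twist !raddf_sum; apply: eq_bigr => m _ /=.
  by rewrite !mcoeffU (can2_eq uK uK).
rewrite mcoeff_sumU ?uK// => m /mcoeff_outdom ->.
by rewrite rmorph0 mul0r.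
Qed.

Lemma twistU b m : twist << b *g m >> = << s b * h (u m) *g u m >>.
Proof.
apply/malgP => k; rewrite twistE !mcoeffU (can2_eq uK uK).
by case: eqP => [->|_]; rewrite ?mulr1n ?uK// !mulr0n rmorph0 mul0r.
Qed.

Lemma twistB : zmod_morphism twist.
Proof.
by move=> a b; apply/malgP => k; rewrite !(mcoeffB, twistE) rmorphB mulrBl.
Qed.

(** Multiplicativity of [h] is asked only on the supports because [h] is
    controlled only on the cone of weights. *)
Lemma twistM (a b : galg B G) : {morph u : m m' / m + m'} ->
  (forall i j, i \in msupp a -> j \in msupp b ->
     h (u i + u j) = h (u i) * h (u j)) ->
  twist (a * b) = twist a * twist b.
Proof.
move=> uD hD.
have tD x y : twist (x + y) = twist x + twist y.
  by apply/malgP => k; rewrite !(mcoeffD, twistE) rmorphD mulrDl.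
have t0 : twist 0 = 0 by rewrite /twist msupp0 big_seq_fset0.
rewrite [in LHS]galgM /gmul (big_morph twist tD t0).
rewrite [RHS]galgM [X in gmul X _]/twist gmul_suml.
rewrite big_seq [RHS]big_seq; apply: eq_bigr => i ia.
rewrite (big_morph twist tD t0) [X in gmul _ X]/twist gmul_sumr.
rewrite big_seq [RHS]big_seq; apply: eq_bigr => j jb.
by rewrite twistU gmulUU uD hD// rmorphM mulrACA.
Qed.

Lemma twist_gconst b : u 0 = 0 -> h 0 = 1 ->
  twist (gconst G b) = gconst G (s b).
Proof. by move=> u0 h0; rewrite /gconst twistU u0 h0 mulr1. Qed.

Lemma twist1 : u 0 = 0 -> h 0 = 1 -> twist 1 = 1.
Proof.
move=> u0 h0; rewrite -[1]/(gconst G 1) twist_gconst//.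
by congr gconst; exact: rmorph1.
Qed.

End Twist.

(** * The real structure on X[Y, D] *)

Section SectionRingInvolution.
Context (R : realType) (n : nat) (t : real_torus R n) (omega : cone n).
Context (K : fieldType) (iota : {rmorphism R[i] -> K}) (Y : scheme_data iota).
Context (sigmaY : Rstructure Y) (D : polyhedral_divisor Y omega).
Context (h : 'rV[int]_n -> K).
Local Notation "m \in_omega" := (cone_set omega (emb m)) (at level 9).
Local Notation tw := (twist (rs_fun sigmaY) (tilde t) h).

Hypothesis omega_stable : forall m, m \in_omega -> (tilde t m) \in_omega.
Hypothesis h_neq0 : forall m, m \in_omega -> h m != 0.
Hypothesis h0 : h 0 = 1.
Hypothesis hD : forall m m', m \in_omega -> m' \in_omega ->
  h (m + m') = h m * h m'.
Hypothesis h_div : forall m, m \in_omega ->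
  eq_div (pullback sigmaY (evaluation D m))
    (fun Z => evaluation D (tilde t m) Z + div (h (tilde t m)) Z).
Hypothesis h_conj : forall m, m \in_omega ->
  h m * rs_fun sigmaY (h (tilde t m)) = 1.

Lemma piece_twist m f :
  piece D m f -> piece D (tilde t m) (rs_fun sigmaY f * h (tilde t m)).
Proof.
move=> [->|[om Df]]; first by left; rewrite rmorph0 mul0r.
right; split; first exact: omega_stable.
exact: H0_pullback (h_neq0 (omega_stable om)) (h_div om) Df.
Qed.

Lemma AD_twist a : a \in AD_pred D -> tw a \in AD_pred D.
Proof.
move=> /AD_predP aD; apply/AD_predP => m; rewrite (twistE _ _ (tildeK t)).
rewrite -[m in piece _ m _](tildeK t) -[m in h m](tildeK t).
exact: piece_twist.
Qed.

Lemma AD_msupp (a : AD D) m : m \in msupp (AD_val a) -> m \in_omega.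
Proof.
rewrite -mcoeff_neq0 => am.
by have [E|[]//] := elimT (AD_predP _ _) (AD_valP a) m; rewrite E eqxx in am.
Qed.

Definition AD_conj (a : AD D) : AD D := MkAD (AD_twist (AD_valP a)).

Lemma AD_conj_zmod : zmod_morphism AD_conj.
Proof.
by move=> a b; apply: val_inj; rewrite /= (twistB _ _ (tildeK t)).
Qed.

Lemma AD_conj_monoid : monoid_morphism AD_conj.
Proof.
split=> [|a b]; apply: val_inj => /=.
  exact: twist1 (tildeK t) (tilde0 t) h0.
apply: (@twistM _ _ (rs_fun sigmaY) _ h (tildeK t) (AD_val a) (AD_val b) (tildeD t)).
by move=> i j ia jb; apply: hD; apply: omega_stable; apply: AD_msupp; eassumption.
Qed.

HB.instance Definition _ :=
  GRing.isZmodMorphism.Build (AD D) (AD D) AD_conj AD_conj_zmod.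
HB.instance Definition _ :=
  GRing.isMonoidMorphism.Build (AD D) (AD D) AD_conj AD_conj_monoid.

(** Applying the map twice multiplies the component of weight [m] by
    sigmaY^#(h(tilde m)) h(m), which is 1 for [m] in the cone. *)
Lemma AD_conjK : involutive AD_conj.
Proof.
move=> a; apply: val_inj; apply/malgP => m /=.
rewrite !(twistE _ _ (tildeK t)) (tildeK t) rmorphM rs_funK -mulrA.
have [/AD_msupp/h_conj E|/mcoeff_outdom ->] :=
  boolP (m \in msupp (AD_val a)); last by rewrite mul0r.
by rewrite [X in _ * X]mulrC E mulr1.
Qed.

Lemma AD_conj_const z : AD_conj (AD_of_const D z) = AD_of_const D z^*.
Proof.
apply: val_inj.
by rewrite /= (twist_gconst _ (tildeK t) _ (tilde0 t) h0) rs_conj.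
Qed.

Lemma mcoeff_coaction (a : AD D) m :
  (coaction a)@_m = homogeneous_component a m.
Proof.
rewrite mcoeff_sumU// => k /mcoeff_outdom ak.
by apply: val_inj; rewrite /= ak monalgU0.
Qed.

(** As [tau] permutes the characters, tensoring with it only moves weights. *)
Lemma tensor_chi (B : comNzRingType) (c : {rmorphism R[i] -> B}) (s : B -> B) g :
  tensor c s (comorphism t) g =
  \sum_(m <- msupp g) << s g@_m *g tilde t m >> :> laurent n B.
Proof.
apply: eq_bigr => m _; rewrite comorphism_chi msupp_chi big_seq_fset1.
by rewrite mcoeffUU rmorph1 mulr1.
Qed.

Lemma AD_conj_homogeneous a m :
  AD_conj (homogeneous_component a m) =
  homogeneous_component (AD_conj a) (tilde t m).
Proof.
apply: val_inj; rewrite /= (twistU _ _ (tildeK t)).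
by rewrite (twistE _ _ (tildeK t)) (tildeK t).
Qed.

Lemma coaction_AD_conj a :
  coaction (AD_conj a) =
  tensor (AD_of_const D) AD_conj (comorphism t) (coaction a).
Proof.
rewrite tensor_chi; apply/malgP => k.
(* The right-hand side is itself a twist, over [A[M]] and with [h] constantly 1. *)
have -> : (\sum_(m <- msupp (coaction a))
      << AD_conj (coaction a)@_m *g tilde t m >>)@_k =
    (twist AD_conj (tilde t) (fun=> 1) (coaction a))@_k.
  by congr (_@__); apply: eq_bigr => m _; rewrite mulr1.
rewrite (twistE _ _ (tildeK t)) mulr1 !mcoeff_coaction.
by have := AD_conj_homogeneous a (tilde t k); rewrite (tildeK t k) => <-.
Qed.

Lemma Rstructure_XD : exists sigma : Rstructure (XD D), real_torus_acts t sigma.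
Proof.
have [sigma sigmaE] := Spec_involution AD_conjK AD_conj_const.
exists sigma => a; have -> : comorphism sigma = AD_conj by exact/funext.
exact: coaction_AD_conj.
Qed.

End SectionRingInvolution.

Theorem theorem1 (R : realType) (n : nat) (tau : real_torus R n)
    (omega : cone n)
    (omega_full : full_dimensional omega)
    (omega_stable :
      linear_extension (tilde tau) @` cone_set omega = cone_set omega)
    (K : fieldType) (iota : {rmorphism R[i] -> K}) (Y : scheme_data iota)
    (Y_variety : variety Y) (Y_normal : normal_scheme Y)
    (Y_semi_projective : semi_projective Y)
    (sigmaY : Rstructure Y)
    (D : polyhedral_divisor Y omega) (D_proper : proper_divisor D) :
  (exists h : 'rV[int]_n -> K,
    [/\ forall m, cone_set omega (emb m) -> h m != 0,
        h 0 = 1,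
        forall m m', cone_set omega (emb m) -> cone_set omega (emb m') ->
          h (m + m') = h m * h m' &
        forall m, cone_set omega (emb m) ->
          eq_div (pullback sigmaY (evaluation D m))
            (fun Z => evaluation D (tilde tau m) Z +
                      div (h (tilde tau m)) Z) /\
          h m * rs_fun sigmaY (h (tilde tau m)) = 1]) ->
  exists sigma : Rstructure (XD D), real_torus_acts tau sigma.
Proof.
move=> [h [h_neq0 h0 hD hE]].
apply: (Rstructure_XD (tilde_cone omega_stable) h_neq0 h0 hD) => m om.
  exact: (hE m om).1.
exact: (hE m om).2.
Qed.
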